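(* Let $S\subset k^3$ be a rational ruled surface. Then $S$ can be covered with at most two rational surface parametrizations; that is, there exist rational parametrizations $\mathcal{P}_1,\mathcal{P}_2:k^2\dashrightarrow S$ of $S$ (possibly equal) such that $S=\mathrm{Image}(\mathcal{P}_1)\cup\mathrm{Image}(\mathcal{P}_2)$.
   Context: $k$ is an algebraically closed field of characteristic zero. A surface is an irreducible Zariski-closed subset of $k^3$ of dimension 2. A rational parametrization of a surface $S$ is a triple of rational functions in $k(s,t)$ defining a dominant rational map $k^2\dashrightarrow S$; its image is the set of its values at those points $(s_0,t_0)\in k^2$ where all three components (in reduced form) have nonvanishing denominators. A rational ruled surface is a surface $S\subset k^3$ that admits a rational parametrization of the form $(s,t)\mapsto\left(\frac{\alpha_i(s)+t\beta_i(s)}{\gamma(s)}\right)_{i=1,2,3}$ with $\alpha_i,\beta_i,\gamma\in k[s]$, $\gamma\neq 0$. *)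

(* Defs.v *)
From HB Require Import structures.
From mathcomp Require Import all_boot all_order all_algebra.
From mathcomp Require Import fraction.
From mathcomp Require Import mpoly.
From mathcomp Require Import classical_sets.

Set Implicit Arguments.
Unset Strict Implicit.
Unset Printing Implicit Defensive.

Import GRing.Theory.

Local Open Scope ring_scope.
Local Open Scope classical_set_scope.

Notation affine k n := {ffun 'I_n -> k}.

Section Zariski.
Variables (k : fieldType) (n : nat).

Definition zero_locus (I : set {mpoly k[n]}) : set (affine k n) :=
  [set x | forall p, I p -> p.@[x] = 0].

Definition zariski_closed (Z : set (affine k n)) : Prop :=
  exists I, Z = zero_locus I.

Definition zariski_closure (A : set (affine k n)) : set (affine k n) :=
  [set x | forall Z, zariski_closed Z -> A `<=` Z -> Z x].

Definition zariski_irreducible (Z : set (affine k n)) : Prop :=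
  Z !=set0 /\
  forall A B, zariski_closed A -> zariski_closed B ->
    Z `<=` A `|` B -> Z `<=` A \/ Z `<=` B.

(* Z_0 < Z_1 < ... < Z_d, all irreducible, closed and contained in Z. *)
Definition irreducible_chain (Z : set (affine k n)) (d : nat)
    (C : nat -> set (affine k n)) : Prop :=
  (forall i, (i <= d)%N ->
     [/\ zariski_closed (C i), zariski_irreducible (C i) & C i `<=` Z]) /\
  (forall i, (i < d)%N -> C i `<` C i.+1).

(* Krull dimension of a closed set. *)
Definition has_dimension (Z : set (affine k n)) (d : nat) : Prop :=
  (exists C, irreducible_chain Z d C) /\
  ~ (exists C, irreducible_chain Z d.+1 C).

End Zariski.

Section Parametrization.
Variable k : fieldType.

Definition surface (S : set (affine k 3)) : Prop :=
  [/\ zariski_closed S, zariski_irreducible S & has_dimension S 2].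

(* The field k(s,t), with s = 'X_0 and t = 'X_1. *)
Definition ratfun2 : Type := {fraction {mpoly k[2]}}.

Definition reduced_form (f : ratfun2) (p q : {mpoly k[2]}) : Prop :=
  [/\ q != 0, f = tofrac p / tofrac q
    & forall d p' q', p = d * p' -> q = d * q' -> d \is a GRing.unit].

(* f is defined at x, with value v; by coprimality the choice of p and q is
   immaterial. *)
Definition ratfun_value (f : ratfun2) (x : affine k 2) (v : k) : Prop :=
  exists p q, [/\ reduced_form f p q, q.@[x] != 0 & v = p.@[x] / q.@[x]].

Definition ratmap_image (P : 'I_3 -> ratfun2) : set (affine k 3) :=
  [set y | exists x : affine k 2, forall i, ratfun_value (P i) x (y i)].

(* Dominance of P : k^2 --> S. *)
Definition rational_parametrization (S : set (affine k 3))
    (P : 'I_3 -> ratfun2) : Prop :=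
  ratmap_image P `<=` S /\ S `<=` zariski_closure (ratmap_image P).

Definition poly_in_s (p : {poly k}) : {mpoly k[2]} :=
  (map_poly (@mpolyC 2 k) p).['X_0].

Definition ruled_map (alpha beta : 'I_3 -> {poly k}) (gamma : {poly k}) :
    'I_3 -> ratfun2 :=
  fun i => tofrac (poly_in_s (alpha i) + 'X_1 * poly_in_s (beta i)) /
           tofrac (poly_in_s gamma).

Definition rational_ruled_surface (S : set (affine k 3)) : Prop :=
  surface S /\
  exists (alpha beta : 'I_3 -> {poly k}) (gamma : {poly k}),
    gamma != 0 /\ rational_parametrization S (ruled_map alpha beta gamma).

End Parametrization.

(* Main.v *)
(* Write the ruled map as (alpha + t beta) / gamma.  Dividing by s - s0 at the
   common zeros of beta, and at the zeros s0 of gamma where alpha and beta are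
   proportional (after subtracting a multiple of beta from alpha), one reaches a
   form in which the 2 x 2 minors of (alpha - gamma y, beta) vanish at s exactly
   when y lies on the line of parameter s.  If beta = 0, the entries of
   alpha - gamma y play this role.  Then the only points of S that the
   normalized map can miss lie on the limit line s = oo, and these are covered
   by the normalized form of the map in 1/s: a point y0 where neither system of
   equations has a root at a finite s, resp. at 1/s = 0, is separated from S by
   a maximal minor of a Sylvester-type matrix. *)

Require Import Defs.
From mathcomp Require Import all_boot all_order all_algebra.
From mathcomp Require Import fraction.
From mathcomp Require Import mpoly.
From mathcomp Require Import boolp classical_sets.
From mathcomp Require Import ring.

Set Implicit Arguments.
Unset Strict Implicit.
Unset Printing Implicit Defensive.

Import GRing.Theory.

Local Open Scope ring_scope.
Local Open Scope classical_set_scope.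

(** * Values of rational functions in two variables *)

Section RationalFunctions.
Variable k : closedFieldType.
Implicit Types (f g : ratfun2 k) (p q : {mpoly k[2]}) (x : affine k 2).

(* Kronecker substitution: s = z and t = z ^ N separates the monomials of p
   as soon as N exceeds its degree. *)
Lemma exists_nonzero_value p : p != 0 -> exists x, p.@[x] != 0.
Proof.
move=> p0; pose N := msize p.
pose e (m : 'X_{1..2}) := (m ord0 + N * m ord_max)%N.
pose q : {poly k} := \sum_(m <- msupp p) p@_m *: 'X^(e m).
have mN m : m \in msupp p -> (m ord0 < N)%N.
  move=> mp; apply: leq_ltn_trans (msize_mdeg_lt mp).
  by rewrite mdegE (bigD1 ord0) //= leq_addr.
have e_inj m m' : m \in msupp p -> m' \in msupp p -> e m = e m' -> m = m'.
  move=> /mN mlt /mN mlt' ee; have N0 : (0 < N)%N by apply: leq_ltn_trans mlt.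
  have E0 : m ord0 = m' ord0.
    by move/(congr1 (modn^~ N)): ee; rewrite /e ![(N * _)%N]mulnC
      ![(_ + _ * N)%N]addnC !modnMDl !modn_small.
  have E1 : m ord_max = m' ord_max.
    by move/eqP: ee; rewrite /e E0 eqn_add2l eqn_pmul2l // => /eqP.
  apply/mnmP => i; case: (unliftP ord_max i) => [j ->|->] //.
  by rewrite (_ : lift _ j = ord0) //; apply: val_inj; case: j => -[].
have q0 : q != 0.
  have [m mp] : exists m, m \in msupp p.
    case E: (msupp p) => [|m l]; last by exists m; rewrite inE eqxx.
    by move/eqP: E; rewrite msupp_eq0 (negbTE p0).
  apply/eqP => /(congr1 (fun r : {poly k} => r`_(e m))).
  rewrite coef0 coef_sum (bigD1_seq m) ?msupp_uniq //= coefZ coefXn eqxx mulr1.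
  rewrite big_seq_cond big1 ?addr0 => [|m' /andP[m'p m'm]].
    by apply/eqP; rewrite -mcoeff_msupp.
  rewrite coefZ coefXn; case: eqP => [ee|]; last by rewrite mulr0.
  by rewrite (e_inj m' m) ?eqxx in m'm.
have /closed_nonrootP[z zq] := q0.
exists [ffun i : 'I_2 => if i == ord0 then z else z ^+ N].
suff -> : p.@[[ffun i : 'I_2 => if i == ord0 then z else z ^+ N]] = q.[z] by [].
rewrite mevalE horner_sum; apply: eq_bigr => m _.
rewrite hornerZ hornerXn /e exprD exprM !big_ord_recr big_ord0 /= mul1r !ffunE /=.
by do 4?f_equal; apply: val_inj.
Qed.

(** Any fraction representing [f] may be used, not only a reduced one. This form is stable under
    sums and products, and [ratfun_value_defined] shows that it gives the same values. *)
Definition defined_at f x (v : k) : Prop :=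
  exists p q, [/\ q.@[x] != 0, f = tofrac p / tofrac q & v = p.@[x] / q.@[x]].

(** Induction on the size of [q]: a common factor that is not a unit is nonconstant, so cancelling
    it lowers this size. Since [q] does not vanish at [x], neither does the factor, and the value is
    kept. *)
Lemma reduce_fraction p q x : q.@[x] != 0 ->
  exists p' q', [/\ reduced_form (tofrac p / tofrac q) p' q', q'.@[x] != 0
    & p.@[x] / q.@[x] = p'.@[x] / q'.@[x]].
Proof.
move: {2}(msize q) (leqnn (msize q)) => n.
elim: n p q => [|n IH] p q.
  by rewrite leqn0 msize_poly_eq0 => /eqP->; rewrite meval0 eqxx.
move=> qn qx; have q0 : q != 0 by apply: contraNneq qx => ->; rewrite meval0.
case: (pselect (forall d p' q', p = d * p' -> q = d * q' -> d \is a GRing.unit)).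
  by exists p, q.
move=> /existsNP[d /existsNP[p' /existsNP[q' /not_implyP[Ep /not_implyP[Eq dU]]]]].
have [d0 q'0] : d != 0 /\ q' != 0.
  by move: q0; rewrite Eq mulf_eq0 negb_or => /andP[].
move: qx; rewrite Eq mevalM mulf_eq0 negb_or => /andP[dx q'x].
have q'n : (msize q' <= n)%N.
  have d1 : (1 < msize d)%N.
    rewrite ltnNge; apply/negP => /msize1_polyC Ed; apply: dU.
    rewrite Ed in d0 *; rewrite mpolyC_eq0 in d0.
    by apply: rmorph_unit; rewrite unitfE.
  rewrite -ltnS; apply: leq_trans qn; rewrite Eq msizeM //.
  by rewrite -(subnKC d1) addSn /= -[X in (X <= _)%N]add1n leq_add2r.
have [p1 [q1 [red q1x E]]] := IH p' q' q'n q'x.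
exists p1, q1; split=> //; last first.
  by rewrite -E Ep !mevalM invfM mulrACA divff // mul1r.
suff -> : tofrac p / tofrac (d * q') = tofrac p' / tofrac q' :> ratfun2 k by [].
rewrite Ep !tofracM invfM mulrACA divff ?mul1r //.
by rewrite tofrac_eq0.
Qed.

Lemma ratfun_value_defined f x v : ratfun_value f x v <-> defined_at f x v.
Proof.
split=> [[p [q [[_ -> _] qx ->]]]|[p [q [qx -> ->]]]]; first by exists p, q.
have [p' [q' [red q'x ->]]] := reduce_fraction p qx.
by exists p', q'.
Qed.

Lemma ratmap_imageP (P : 'I_3 -> ratfun2 k) y :
  ratmap_image P y <-> exists x : affine k 2, forall i, defined_at (P i) x (y i).
Proof. by split=> -[x xy]; exists x => i; apply/ratfun_value_defined. Qed.

Lemma defined_at_uniq f x v v' : defined_at f x v -> defined_at f x v' -> v = v'.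
Proof.
move=> [p [q [qx -> ->]]] [p' [q' [q'x + ->]]].
have [q0 q'0] : q != 0 /\ q' != 0.
  by split; [apply: contraNneq qx|apply: contraNneq q'x] => ->; rewrite meval0 eqxx.
move/eqP; rewrite eqr_div ?tofrac_eq0 // -!tofracM tofrac_eq => /eqP E.
by apply/eqP; rewrite eqr_div // -!mevalM E.
Qed.

Lemma defined_atC c x : defined_at (tofrac c%:MP) x c.
Proof. by exists c%:MP, 1; rewrite tofrac1 meval1 mevalC oner_eq0 !divr1. Qed.

Lemma defined_atD f g x u v :
  defined_at f x u -> defined_at g x v -> defined_at (f + g) x (u + v).
Proof.
move=> [p [q [qx -> ->]]] [p' [q' [q'x -> ->]]].
have [q0 q'0] : q != 0 /\ q' != 0.
  by split; [apply: contraNneq qx|apply: contraNneq q'x] => ->; rewrite meval0 eqxx.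
exists (p * q' + p' * q), (q * q'); split.
- by rewrite mevalM mulf_neq0.
- by rewrite addf_div ?tofrac_eq0 // -!tofracM -tofracD.
- by rewrite addf_div // mevalD !mevalM.
Qed.

Lemma defined_atM f g x u v :
  defined_at f x u -> defined_at g x v -> defined_at (f * g) x (u * v).
Proof.
move=> [p [q [qx -> ->]]] [p' [q' [q'x -> ->]]].
by exists (p * p'), (q * q'); rewrite !mevalM !tofracM mulf_neq0 // !mulf_div.
Qed.

Lemma defined_at_comp n (F : {mpoly k[n]}) (P : 'I_n -> ratfun2 k) x (y : 'I_n -> k) :
  (forall i, defined_at (P i) x (y i)) ->
  defined_at (mmap (@tofrac _ \o @mpolyC 2 k) P F) x F.@[y].
Proof.
move=> Py.
have d0 : defined_at 0 x 0 by rewrite -tofrac0 -(@mpolyC0 2 k); apply: defined_atC.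
have d1 : defined_at 1 x 1 by rewrite -{1}tofrac1 -mpolyC1; apply: defined_atC.
rewrite mevalE /mmap.
apply: (big_ind2 (fun u v => defined_at u x v)) => // [u v u' v'|m _].
  exact: defined_atD.
apply: defined_atM; first exact: defined_atC.
apply: (big_ind2 (fun u v => defined_at u x v)) => // [u v u' v'|i _].
  exact: defined_atM.
elim: (m i) => [|j IH]; first by rewrite !expr0.
by rewrite !exprS; apply: defined_atM.
Qed.

(* Vanishing at a general parameter means vanishing in k(s,t), which is then
   inherited by all the values. *)
Lemma vanish_on_image (F : {mpoly k[3]}) (P : 'I_3 -> ratfun2 k) (g : {mpoly k[2]}) :
  g != 0 ->
  (forall x (y : affine k 3), g.@[x] != 0 ->
     (forall i, defined_at (P i) x (y i)) -> F.@[y] = 0) ->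
  forall y, ratmap_image P y -> F.@[y] = 0.
Proof.
move=> g0 Fg y /ratmap_imageP[x Py].
set f := mmap (@tofrac _ \o @mpolyC 2 k) P F.
suff f0 : f = 0.
  apply: (defined_at_uniq (defined_at_comp F Py)); rewrite -/f f0.
  by rewrite -tofrac0 -(@mpolyC0 2 k); apply: defined_atC.
have [p [q [qx fE _]]] := defined_at_comp F Py; rewrite -/f in fE.
have Pd i : exists d : {mpoly k[2]}, d != 0 /\
    forall z : affine k 2, d.@[z] != 0 -> exists v, defined_at (P i) z v.
  have [pi [qi [qix PiE _]]] := Py i; exists qi; split.
    by apply: contraNneq qix => ->; rewrite meval0.
  by move=> z qiz; exists (pi.@[z] / qi.@[z]), pi, qi.
have [d dP] := fin_all_exists Pd.
have q0 : q != 0 by apply: contraNneq qx => ->; rewrite meval0.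
have [p0|p0] := eqVneq p 0; first by rewrite fE p0 tofrac0 mul0r.
(* At such a [z] the fraction [p / q] has a nonzero value, all components of [P] are defined and [g]
   is nonzero; the hypothesis on [F] then forces this value to be zero. *)
have /exists_nonzero_value[z] : p * q * g * \prod_i d i != 0.
  rewrite !mulf_neq0 //; apply/prodf_neq0 => i _; exact: proj1 (dP i).
rewrite !mevalM !mulf_eq0 !negb_or => /andP[/andP[/andP[pz qz] gz] dz].
have Pz i : exists v, defined_at (P i) z v.
  apply: (proj2 (dP i)); apply: contraNneq dz => dz.
  by rewrite (bigD1 i) //= mevalM dz mul0r.
have [v vP] := fin_all_exists Pz.
have Pv i : defined_at (P i) z ([ffun i => v i] i) by rewrite ffunE.
have fz : defined_at f z (p.@[z] / q.@[z]) by exists p, q.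
move: (defined_at_uniq fz (defined_at_comp F Pv)).
rewrite (Fg z _ gz Pv) => /eqP; rewrite mulf_eq0 invr_eq0.
by rewrite (negbTE pz) (negbTE qz).
Qed.
End RationalFunctions.

(** * Elimination of the parameter *)

Section Elimination.
Variable k : closedFieldType.

Lemma meval_map_mpolyC n (y : 'I_n -> k) (p : {poly k}) :
  map_poly (meval y) (map_poly (@mpolyC n k) p) = p.
Proof. by rewrite -map_poly_comp map_poly_id // => c _ /=; rewrite mevalC. Qed.

Lemma size_mul_bound (p q : {poly k}) a b :
  (size p <= a -> size q <= b.+1 -> size (p * q)%R <= a + b)%N.
Proof.
move=> pa qb; apply: leq_trans (size_polyMleq _ _) _.
by rewrite -subn1 leq_subLR add1n -addnS leq_add.
Qed.

(** Ideals of [k[s]] are principal: each new element of [r] is absorbed by a Bezout relation between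
    it and the generator found so far. *)
Lemma ideal_generator (J : finType) (w : J -> {poly k}) (r : seq J) :
  exists h : J -> {poly k}, forall j, j \in r -> \sum_i h i * w i %| w j.
Proof.
elim: r => [|a r [h hw]]; first by exists (fun=> 0).
set g := \sum_i h i * w i in hw.
have [[u v] /= E] := Bezoutp (w a) g.
exists (fun i => v * h i + (i == a)%:R * u) => j.
have -> : \sum_i (v * h i + (i == a)%:R * u) * w i = u * w a + v * g.
  under eq_bigr do rewrite mulrDl.
  rewrite big_split /= addrC; congr (_ + _).
    rewrite (bigD1 a) //= eqxx mul1r big1 ?addr0 // => i /negbTE->.
    by rewrite !mul0r.
  by rewrite /g mulr_sumr; apply: eq_bigr => i _; rewrite mulrA.
rewrite (eqp_dvdl _ E) inE => /orP[/eqP->|jr]; first exact: dvdp_gcdl.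
by apply: dvdp_trans (dvdp_gcdr _ _) (hw _ jr).
Qed.

(** A root of the generator would be a common root of the family, so the generator is a nonzero
    constant. *)
Lemma nullstellensatz_univariate (J : finType) (w : J -> {poly k}) :
  (forall s, exists j, (w j).[s] != 0) -> exists h : J -> {poly k}, \sum_i h i * w i = 1.
Proof.
move=> nz; have [h hw] := ideal_generator w (enum J).
set g := \sum_i h i * w i in hw.
have [g1|] := eqVneq (size g) 1%N; last first.
  move=> /closed_rootP[s gs]; have [j /negP[]] := nz s.
  rewrite -/(root _ s) -dvdp_XsubCl.
  by apply: dvdp_trans (hw _ _); rewrite ?mem_enum // dvdp_XsubCl.
have /size_poly1P[c c0 gc] : size g == 1%N by rewrite g1.
exists (fun i => c^-1 *: h i).
under eq_bigr do rewrite -scalerAl.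
by rewrite -scaler_sumr -/g gc -mul_polyC -polyCM mulVf.
Qed.

(** Starting from a Bezout relation multiplied by [p], the coefficients other than that of [w j0]
    are reduced modulo [w j0], to degree below [d]. The coefficient of [w j0] takes up the
    quotients; its product with [w j0] has degree at most 2d, so its own degree is at most [d]. *)
Lemma bounded_combination (J : finType) (w : J -> {poly k}) (j0 : J) (p : {poly k}) d :
  (forall s, exists j, (w j).[s] != 0) ->
  (forall j, (size (w j) <= size (w j0))%N) -> size (w j0) = d.+1 ->
  (size p <= d.*2.+1)%N ->
  exists r : J -> {poly k},
    (forall j, (size (r j) <= d.+1)%N) /\ \sum_j r j * w j = p.
Proof.
move=> nz wd dE pd; have [h hE] := nullstellensatz_univariate nz.
have m0 : w j0 != 0 by rewrite -size_poly_eq0 dE.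
pose r j : {poly k} := (p * h j) %% w j0.
pose r0 : {poly k} := p * h j0 + \sum_(j | j != j0) ((p * h j) %/ w j0) * w j.
have E : r0 * w j0 + \sum_(j | j != j0) r j * w j = p.
  rewrite /r0 mulrDl -addrA mulr_suml -big_split /=.
  rewrite -[RHS]mulr1 -hE mulr_sumr [RHS](bigD1 j0) //= mulrA; congr (_ + _).
  apply: eq_bigr => j _; rewrite [RHS]mulrA [in RHS](divp_eq (p * h j) (w j0)).
  by rewrite -/(r j) mulrDl mulrAC.
have rd j : (size (r j) <= d)%N by rewrite -ltnS -dE /r ltn_modp.
exists (fun j => if j == j0 then r0 else r j); split; last first.
  rewrite -[RHS]E (bigD1 j0) //= eqxx; congr (_ + _).
  by apply: eq_bigr => j /negbTE->.
move=> j; case: ifP => _; last by apply: leq_trans (rd j) _.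
have [->|r00] := eqVneq r0 0; first by rewrite size_poly0.
have: (size (r0 * w j0)%R <= d.*2.+1)%N.
  have -> : r0 * w j0 = p - \sum_(j | j != j0) r j * w j by rewrite -[in RHS]E addrK.
  rewrite (leq_trans (size_polyD _ _)) // geq_max pd size_polyN.
  apply: leq_trans (size_sum _ _ _) _; apply/bigmax_leqP => i _.
  apply: leq_trans (size_mul_bound (rd i) (_ : _ <= d.+1)%N) _; rewrite -?dE ?wd //.
  by rewrite addnn.
by rewrite size_mul // dE addnS /= -addnn -addSn leq_add2r.
Qed.


(** [F] is the determinant of the coefficients of 2d+1 combinations of the [W j], chosen to
    specialize at [y0] to the monomials ['X^l]; hence its value at [y0] is 1. The size bound on
    [w y] keeps every combination in degree at most 2d, so no coefficient is cut off. *)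
Lemma elimination n (J : finType) (W : J -> {poly {mpoly k[n]}})
    (w := fun (y : affine k n) j => map_poly (meval y) (W j)) (y0 : affine k n) (j0 : J) :
  (forall s, exists j, (w y0 j).[s] != 0) ->
  (forall j, (size (w y0 j) <= size (w y0 j0))%N) ->
  exists F : {mpoly k[n]}, F.@[y0] != 0 /\
    forall y s, (forall j, (size (w y j) <= size (w y0 j0))%N) ->
      (forall j, (w y j).[s] = 0) -> F.@[y] = 0.
Proof.
move=> nz wd; have m0 : (0 < size (w y0 j0))%N.
  rewrite lt0n; apply/eqP => E; have [j] := nz 0.
  by move: (wd j); rewrite E leqn0 size_poly_eq0 => /eqP->; rewrite horner0 eqxx.
set d := (size (w y0 j0)).-1.
have dE : size (w y0 j0) = d.+1 by rewrite prednK.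
have R (l : 'I_d.*2.+1) : exists r : J -> {poly k},
    (forall j, (size (r j) <= d.+1)%N) /\ \sum_j r j * w y0 j = 'X^l.
  by apply: bounded_combination nz wd dE _; rewrite size_polyXn.
have [r rP] := fin_all_exists R.
pose M : 'M[{mpoly k[n]}]_(d.*2.+1) := \matrix_(c, l)
  (\sum_j map_poly (@mpolyC n k) (r l j) * W j)`_c.
have ME (y : affine k n) : map_mx (meval y) M = \matrix_(c, l) (\sum_j r l j * w y j)`_c.
  apply/matrixP => c l; rewrite !mxE -coef_map.
  apply: (congr1 (fun p : {poly k} => p`_c)).
  rewrite rmorph_sum /=. apply: eq_bigr => j _; rewrite rmorphM /=; congr (_ * _).
  exact: meval_map_mpolyC.
exists (\det M); split.
  rewrite -det_map_mx ME (_ : \matrix_(c, l) _ = 1%:M) ?det1 ?oner_eq0 //.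
  by apply/matrixP => c l; rewrite !mxE (proj2 (rP l)) coefXn.
move=> y s yd ys; rewrite -det_map_mx ME; apply/eqP/det0P.
(* The powers of the common root form a left null vector: multiplying by them evaluates each
   combination at [s]. The entry of index 0 is 1, so the vector is nonzero. *)
exists (\row_(c < d.*2.+1) s ^+ c).
  apply/eqP => /rowP/(_ ord0)/eqP; rewrite !mxE expr0; exact/negP/oner_neq0.
apply/rowP => l; rewrite !mxE.
under eq_bigr do rewrite !mxE mulrC.
rewrite -horner_coef_wide; last first.
  apply: leq_trans (size_sum _ _ _) _; apply/bigmax_leqP => i _.
  have := size_mul_bound (proj1 (rP l) i) (_ : (size (w y i) <= d.+1)%N).
  by rewrite -{1}dE -addnn => /(_ (yd i)).
by rewrite horner_sum big1 // => j _; rewrite hornerM ys mulr0.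
Qed.

End Elimination.

(** * The substitution of 1/s for s *)

Section Reversal.
Variable k : closedFieldType.
Implicit Types (p q : {poly k}) (s : k).

(** This is X^D p(1/X). It is used with [size p <= D], one more than the degree requires; the
    resulting extra factor X is harmless. *)
Definition rev_poly D p : {poly k} := \poly_(i < D.+1) p`_(D - i).

Lemma coef_rev_poly D p i : (i <= D)%N -> (rev_poly D p)`_i = p`_(D - i).
Proof. by move=> iD; rewrite coef_poly ltnS iD. Qed.

Lemma horner_rev_poly D p s : (size p <= D)%N -> s != 0 ->
  (rev_poly D p).[s] = s ^+ D * p.[s^-1].
Proof.
move=> pD s0; rewrite horner_poly (@horner_coef_wide _ D.+1 p s^-1 (leqW pD)).
rewrite mulr_sumr (reindex_inj rev_ord_inj); apply: eq_bigr => i _ /=.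
have iD : (i <= D)%N by rewrite -ltnS.
rewrite subSS subKn // mulrCA; congr (_ * _).
by rewrite exprVn; apply: canRL (mulfK _) _; rewrite ?expf_neq0 // -exprD subnK.
Qed.

Lemma rev_poly_eq0 D p : (size p <= D)%N -> (rev_poly D p == 0) = (p == 0).
Proof.
move=> pD; apply/eqP/eqP => [/polyP p0|->]; apply/polyP => i; rewrite coef0; last first.
  by rewrite coef_poly coef0 if_same.
have [iD|iD] := leqP i D; last by rewrite nth_default // (leq_trans pD) // ltnW.
by rewrite -[i](subKn iD) -coef_rev_poly ?leq_subr // p0 coef0.
Qed.

(** Transports a condition on general [s] to 1/s. The factor ['X] of the witness excludes s = 0. *)
Lemma nonroot_inv p : p != 0 ->
  exists2 q, q != 0 & forall s, q.[s] != 0 -> s != 0 /\ p.[s^-1] != 0.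
Proof.
move=> p0; exists ('X * rev_poly (size p) p).
  by rewrite mulf_neq0 ?polyX_eq0 // rev_poly_eq0.
move=> s; rewrite hornerM hornerX mulf_eq0 negb_or => /andP[s0].
by rewrite horner_rev_poly // mulf_eq0 negb_or => /andP[_ ->].
Qed.

Lemma eq_poly_off_roots p q c :
  c != 0 -> (forall s, c.[s] != 0 -> p.[s] = q.[s]) -> p = q.
Proof.
move=> c0 E; apply/eqP; rewrite -subr_eq0; apply/negPn/negP => pq0.
have /closed_nonrootP[s] : c * (p - q) != 0 by rewrite mulf_neq0.
by rewrite rootE hornerM hornerD hornerN mulf_eq0 negb_or subr_eq0 => /andP[/E -> /eqP].
Qed.

(* Compare the orders at s = 0: q(1/s) has a pole of order deg q there, v has
   none and u does not vanish. *)
Lemma size_le_of_inv_ratio p q u v c :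
  u.[0] != 0 -> c != 0 ->
  (forall s, c.[s] != 0 -> s != 0 /\ v.[s] * q.[s^-1] = u.[s] * p.[s^-1]) ->
  (size p <= size q)%N.
Proof.
move=> u0 c0 E; set D := maxn (size p) (size q).
have [pD qD] : (size p <= D)%N /\ (size q <= D)%N by rewrite leq_maxl leq_maxr.
have rE : v * rev_poly D q = u * rev_poly D p.
  apply: (eq_poly_off_roots c0) => s /E[s0 Es].
  by rewrite !hornerM !horner_rev_poly // mulrCA Es mulrCA.
have qX : 'X^(D.+1 - size q) %| rev_poly D q.
  rewrite -(poly_take_drop (D.+1 - size q) (rev_poly D q)).
  rewrite (_ : take_poly _ _ = 0) ?add0r ?dvdp_mull //.
  apply/polyP => i; rewrite coef_take_poly coef0; case: ltnP => // iD.
  rewrite coef_poly; case: ltnP => // iD'; rewrite nth_default //.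
  by rewrite leq_subRL // addnC -ltnS -ltn_subRL.
have : 'X^(D.+1 - size q) %| rev_poly D p.
  rewrite -(@Gauss_dvdpr _ _ u) -?rE ?dvdp_mull // coprimep_expl //.
  by rewrite coprimep_sym coprimepX rootE.
move=> /dvdpP[r rp]; apply/leq_sizeP => i qi.
have [iD|iD] := ltnP D i; first by rewrite nth_default // (leq_trans pD) // ltnW.
rewrite -[i](subKn iD) -coef_rev_poly ?leq_subr // rp coefMXn ifT //.
by rewrite subSn // ltnS leq_sub2l.
Qed.
End Reversal.

(** * Points and images of ruled maps *)

Section Ruled.
Variable k : closedFieldType.
Implicit Types (a b : 'I_3 -> {poly k}) (g : {poly k}) (y : affine k 3) (s t : k).

(** Denominators are cleared, so that the relation also makes sense at the zeros of [g]. *)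
Definition on_line a b g s t y := forall i, (a i).[s] + t * (b i).[s] = g.[s] * y i.

Lemma meval_poly_in_s (p : {poly k}) (x : affine k 2) : (poly_in_s p).@[x] = p.[x ord0].
Proof.
by rewrite /poly_in_s -horner_map /= mevalXU meval_map_mpolyC.
Qed.

Lemma poly_in_s_neq0 g : g != 0 -> poly_in_s g != 0.
Proof.
move=> /closed_nonrootP[s gs]; apply: contraNneq gs => g0.
have := meval_poly_in_s g [ffun => s]; rewrite ffunE g0 meval0 => E.
by rewrite rootE -E.
Qed.

Lemma ruled_map_defined a b g i (x : affine k 2) (v : k) : g.[x ord0] != 0 ->
  defined_at (ruled_map a b g i) x v <->
  (a i).[x ord0] + x ord_max * (b i).[x ord0] = g.[x ord0] * v.
Proof.
move=> gx; have x1 : x 1 = x ord_max by congr (x _); apply: val_inj.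
have V : defined_at (ruled_map a b g i) x
    (((a i).[x ord0] + x ord_max * (b i).[x ord0]) / g.[x ord0]).
  exists (poly_in_s (a i) + 'X_1 * poly_in_s (b i)), (poly_in_s g).
  rewrite mevalD mevalM mevalXU !meval_poly_in_s x1; split=> //.
split=> [/(defined_at_uniq V) <-|E]; first by rewrite mulrCA divff // mulr1.
by move: V; rewrite E mulrAC divff // mul1r.
Qed.

Lemma ruled_map_image a b g s t y :
  g.[s] != 0 -> on_line a b g s t y -> ratmap_image (ruled_map a b g) y.
Proof.
move=> gs L; apply/ratmap_imageP; exists [ffun i => if i == ord0 then s else t] => i.
by apply/ruled_map_defined; rewrite !ffunE //=; apply: L.
Qed.

(** It suffices to test general [s]: by [vanish_on_image], an equation of [Z] then holds on the
    whole image, including values at zeros of [g] that become defined after cancellation. *)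
Lemma ruled_map_image_closed a b g c (Z X : set (affine k 3)) :
  g != 0 -> c != 0 -> zariski_closed Z -> X `<=` Z ->
  (forall s t y, c.[s] != 0 -> on_line a b g s t y -> X y) ->
  ratmap_image (ruled_map a b g) `<=` Z.
Proof.
move=> g0 c0 [I ->] XZ H y yP F IF.
apply: (@vanish_on_image _ F _ (poly_in_s (g * c)) _ _ y yP).
  by apply: poly_in_s_neq0; rewrite mulf_neq0.
move=> x z; rewrite meval_poly_in_s hornerM mulf_eq0 negb_or => /andP[gx cx] xz.
apply: (XZ z _ F IF); apply: (H (x ord0) (x ord_max)) => // i.
by apply/ruled_map_defined => //; apply: xz.
Qed.

End Ruled.

(** * Covering by a map and its form at infinity *)

Section Cover.
Variables (k : closedFieldType) (S : set (affine k 3)).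
Hypothesis S_closed : zariski_closed S.
Implicit Types (a b : 'I_3 -> {poly k}) (g : {poly k}) (y : affine k 3) (s t : k).

(** When the general points of each map lie in the image of the other, the two images have the same
    closure. *)
Lemma birational_reparametrization a b g a' b' g' c c' :
  g != 0 -> c != 0 -> g' != 0 -> c' != 0 ->
  rational_parametrization S (ruled_map a b g) ->
  (forall s t y, c.[s] != 0 -> on_line a b g s t y ->
     ratmap_image (ruled_map a' b' g') y) ->
  (forall s t y, c'.[s] != 0 -> on_line a' b' g' s t y ->
     ratmap_image (ruled_map a b g) y) ->
  rational_parametrization S (ruled_map a' b' g').
Proof.
move=> g0 c0 g'0 c'0 [PS SP] H H'; split.
  exact: ruled_map_image_closed g'0 c'0 S_closed PS H'.
move=> y /SP yP Z Zc QZ; apply: yP => //.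
exact: ruled_map_image_closed g0 c0 Zc QZ H.
Qed.

(** The roots of [c] are the parameters at which the equations may have spurious solutions; [c = 1]
    expresses that the form is normalized. *)
Definition line_equations (J : finType) a b g
    (w : affine k 3 -> J -> {poly k}) (c : {poly k}) :=
  (forall s t y, on_line a b g s t y -> forall j, (w y j).[s] = 0) /\
  (forall s y, c.[s] != 0 -> (forall j, (w y j).[s] = 0) ->
     g.[s] != 0 /\ exists t, on_line a b g s t y).

(** Index 0 is the given map, 1 its normalized form in s, 2 the normalized form in 1/s. The factors
    [c1], [e1], [c2], [e2] relate the three systems and depend neither on [y] nor on [j]. *)
Lemma cover (J : finType) a0 b0 g0 a1 b1 g1 a2 b2 g2
    (w0 w1 w2 : affine k 3 -> J -> {poly k}) (W1 : J -> {poly {mpoly k[3]}})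
    (c0 c1 e1 c2 e2 : {poly k}) :
  rational_parametrization S (ruled_map a0 b0 g0) ->
  g0 != 0 -> g1 != 0 -> g2 != 0 ->
  c0 != 0 -> c1 != 0 -> e1 != 0 -> c2 != 0 -> e2 != 0 ->
  line_equations a0 b0 g0 w0 c0 -> line_equations a1 b1 g1 w1 1 ->
  line_equations a2 b2 g2 w2 1 ->
  (forall y j, w1 y j = map_poly (meval y) (W1 j)) ->
  (forall y j, c1 * w1 y j = e1 * w0 y j) ->
  (forall y j s, s != 0 -> c2.[s] * (w2 y j).[s] = e2.[s] * (w0 y j).[s^-1]) ->
  exists P1 P2 : 'I_3 -> ratfun2 k,
    [/\ rational_parametrization S P1, rational_parametrization S P2
      & S = ratmap_image P1 `|` ratmap_image P2].
Proof.
move=> PS g0n g1n g2n c0n c1n e1n c2n e2n [L0 M0] [L1 M1] [L2 M2] W1E E1 E2.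
have E1s y j s : c1.[s] * (w1 y j).[s] = e1.[s] * (w0 y j).[s].
  by rewrite -!hornerM E1.
have img1 s y : (forall j, (w1 y j).[s] = 0) -> ratmap_image (ruled_map a1 b1 g1) y.
  move=> /M1; rewrite hornerC oner_neq0 => /(_ isT)[gs [t L]].
  exact: ruled_map_image gs L.
have img2 s y : (forall j, (w2 y j).[s] = 0) -> ratmap_image (ruled_map a2 b2 g2) y.
  move=> /M2; rewrite hornerC oner_neq0 => /(_ isT)[gs [t L]].
  exact: ruled_map_image gs L.
have w01 s y : c1.[s] != 0 -> (forall j, (w0 y j).[s] = 0) -> forall j, (w1 y j).[s] = 0.
  move=> cs w0s j; apply/eqP; move/eqP: (E1s y j s).
  by rewrite w0s mulr0 mulf_eq0 (negbTE cs).
(* The parameter of the second form is the inverse of the given one, so exceptional parameters are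
   carried over by inversion. *)
have [r2 r2n r2P] := nonroot_inv c2n; have [r0 r0n r0P] := nonroot_inv c0n.
have PS1 : rational_parametrization S (ruled_map a1 b1 g1).
  apply: (@birational_reparametrization a0 b0 g0 _ _ _ c1 (e1 * c0)) => //.
  - by rewrite mulf_neq0.
  - by move=> s t y cs /L0 w0s; apply: (img1 s); apply: w01.
  move=> s t y; rewrite hornerM mulf_eq0 negb_or => /andP[es cs] /L1 w1s.
  have [j|gs [u L]] := M0 s y cs; last exact: ruled_map_image gs L.
  by apply/eqP; move/esym/eqP: (E1s y j s); rewrite w1s mulr0 mulf_eq0 (negbTE es).
have PS2 : rational_parametrization S (ruled_map a2 b2 g2).
  apply: (@birational_reparametrization a0 b0 g0 _ _ _ r2 (e2 * r0)) => //.
  - by rewrite mulf_neq0.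
  - move=> s t y /r2P[s0 cs] /L0 w0s; apply: (img2 s^-1) => j; apply/eqP.
    move/eqP: (E2 y j s^-1 (invr_neq0 s0)).
    by rewrite invrK w0s mulr0 mulf_eq0 (negbTE cs).
  move=> s t y; rewrite hornerM mulf_eq0 negb_or => /andP[es /r0P[s0 cs]] /L2 w2s.
  have [j|gs [u L]] := M0 s^-1 y cs; last exact: ruled_map_image gs L.
  by apply/eqP; move/esym/eqP: (E2 y j s s0); rewrite w2s mulr0 mulf_eq0 (negbTE es).
exists (ruled_map a1 b1 g1), (ruled_map a2 b2 g2); split=> //.
apply/seteqP; split=> [y0 Sy0|y [/(proj1 PS1)|/(proj1 PS2)] //].
have [[s w1s]|no1] := pselect (exists s, forall j, (w1 y0 j).[s] = 0).
  by left; apply: img1 w1s.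
have [w20|no2] := pselect (forall j, (w2 y0 j).[0] = 0).
  by right; apply: img2 w20.
exfalso; have /existsNP[j0 /eqP j0n] := no2.
(* As the factors do not depend on [y] and [j], the ratio of [w1 y j] to [w1 y0 j0] at 1/s equals
   that of [w2 y j] to [w2 y0 j0] at s. The latter denominator is nonzero at 0, so the degree of
   [w1 y0 j0] is maximal. *)
have bound y j : (size (w1 y j) <= size (w1 y0 j0))%N.
  have [r1 r1n r1P] := nonroot_inv c1n.
  apply: (@size_le_of_inv_ratio _ _ _ _ (w2 y j) (r1 * c2) j0n).
    by rewrite mulf_neq0.
  move=> s; rewrite hornerM mulf_eq0 negb_or => /andP[/r1P[s0 c1s] c2s]; split=> //.
  apply: (mulfI (mulf_neq0 c1s c2s)).
  transitivity ((c2.[s] * (w2 y j).[s]) * (c1.[s^-1] * (w1 y0 j0).[s^-1])); first by ring.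
  rewrite E2 // E1s.
  transitivity ((c2.[s] * (w2 y0 j0).[s]) * (c1.[s^-1] * (w1 y j).[s^-1])); last by ring.
  rewrite E2 // E1s; ring.
have nz s : exists j, (w1 y0 j).[s] != 0.
  have /existsNP[j /eqP wj] : ~ forall j, (w1 y0 j).[s] = 0.
    by move=> w1s; apply: no1; exists s.
  by exists j.
have [||F [Fy0 Fz]] := @elimination k 3 J W1 y0 j0.
- by move=> s; have [j wj] := nz s; exists j; rewrite -W1E.
- by move=> j; rewrite -!W1E.
case/negP: Fy0; apply/eqP.
have FZ : zariski_closed (zero_locus [set F]) by exists [set F].
(* By density, [F] vanishes at [y0] once it vanishes on the image of the given map, and for this its
   general points suffice. *)
apply: ((proj2 PS) y0 Sy0 _ FZ _ F (erefl F)).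
apply: (@ruled_map_image_closed _ _ _ _ c1 _ _ g0n c1n FZ (fun _ h => h)).
move=> s t y cs /L0 /(w01 _ _ cs) w1s p ->; apply: (Fz y s) => j; rewrite -!W1E //.
Qed.

End Cover.

(** * Equations of the lines and normalization *)

Section Equations.
Variable k : closedFieldType.
Implicit Types (a b : 'I_3 -> {poly k}) (g : {poly k}) (y : affine k 3) (s t : k).

(* The 2 x 2 minors of the rows a - g y and b. *)
Definition line_minors a b g y (ij : 'I_3 * 'I_3) : {poly k} :=
  (a ij.1 - g * (y ij.1)%:P) * b ij.2 - (a ij.2 - g * (y ij.2)%:P) * b ij.1.

Definition point_equations a g y (i : 'I_3) : {poly k} := a i - g * (y i)%:P.

(** Makes the coordinates of y indeterminates, as [elimination] requires. *)
Lemma line_minors_poly a b g : exists W : 'I_3 * 'I_3 -> {poly {mpoly k[3]}},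
  forall y ij, line_minors a b g y ij = map_poly (meval y) (W ij).
Proof.
pose C := map_poly (@mpolyC 3 k).
exists (fun ij => (C (a ij.1) - C g * ('X_ij.1)%:P) * C (b ij.2)
   - (C (a ij.2) - C g * ('X_ij.2)%:P) * C (b ij.1)) => y ij.
by rewrite !(rmorphB, rmorphM) /= !meval_map_mpolyC !map_polyC /= !mevalXU.
Qed.

Lemma point_equations_poly a g : exists W : 'I_3 -> {poly {mpoly k[3]}},
  forall y i, point_equations a g y i = map_poly (meval y) (W i).
Proof.
pose C := map_poly (@mpolyC 3 k).
exists (fun i => C (a i) - C g * ('X_i)%:P) => y i.
by rewrite !(rmorphB, rmorphM) /= !meval_map_mpolyC !map_polyC /= !mevalXU.
Qed.

(** Vanishing minors make a - g y a multiple of the nonzero vector b at [s], which yields [t]. If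
    [g] vanished there, a and b would be proportional, against the second hypothesis. *)
Lemma line_minors_eqs a b g c :
  (forall s, c.[s] != 0 -> exists i, (b i).[s] != 0) ->
  (forall s, c.[s] != 0 -> g.[s] = 0 ->
     exists ij : 'I_3 * 'I_3,
       (a ij.1).[s] * (b ij.2).[s] != (a ij.2).[s] * (b ij.1).[s]) ->
  line_equations a b g (line_minors a b g) c.
Proof.
move=> bn an; split=> [s t y L ij|s y cs M].
  rewrite /line_minors !(hornerD, hornerN, hornerM, hornerC) -!L; ring.
have Ms i j : ((a i).[s] - g.[s] * y i) * (b j).[s] =
    ((a j).[s] - g.[s] * y j) * (b i).[s].
  by move/eqP: (M (i, j)); rewrite !(hornerD, hornerN, hornerM, hornerC) subr_eq0 => /eqP.
have gs : g.[s] != 0.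
  apply/eqP => gs; have [ij /eqP[]] := an s cs gs.
  by move: (Ms ij.1 ij.2); rewrite gs !mul0r !subr0.
split=> //; have [j bj] := bn s cs.
exists (- ((a j).[s] - g.[s] * y j) / (b j).[s]) => i.
apply: (mulIf bj); rewrite mulrDl mulrAC divfK //.
have := Ms i j; move: (a i).[s] (a j).[s] (b i).[s] (b j).[s] => A A' B B' E.
rewrite mulNr -E; ring.
Qed.

Lemma point_equations_eqs a b g c :
  (forall i, b i = 0) ->
  (forall s, c.[s] != 0 -> g.[s] = 0 -> exists i, (a i).[s] != 0) ->
  line_equations a b g (point_equations a g) c.
Proof.
move=> b0 an; split=> [s t y L i|s y cs M].
  by rewrite !(hornerD, hornerN, hornerM, hornerC) -L b0 horner0 mulr0 addr0 subrr.
have Ms i : (a i).[s] = g.[s] * y i.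
  by move/eqP: (M i); rewrite !(hornerD, hornerN, hornerM, hornerC) subr_eq0 => /eqP.
have gs : g.[s] != 0.
  by apply/eqP => gs; have [i /eqP[]] := an s cs gs; rewrite Ms gs mul0r.
by split=> //; exists 0 => i; rewrite mul0r addr0.
Qed.

Lemma size_divp_XsubC (p : {poly k}) s : p != 0 -> p.[s] = 0 ->
  exists2 q, p = q * ('X - s%:P) & size p = (size q).+1.
Proof.
move=> p0 /eqP/factor_theorem[q pq]; exists q => //.
rewrite pq size_mul ?polyXsubC_eq0 ?size_XsubC ?addn2 //.
by apply: contraNneq p0 => q0; rewrite pq q0 mul0r.
Qed.

Lemma common_factor (f : 'I_3 -> {poly k}) s : (forall i, (f i).[s] = 0) ->
  exists f' : 'I_3 -> {poly k}, forall i, f i = f' i * ('X - s%:P).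
Proof.
move=> fs; have H i : exists q, f i = q * ('X - s%:P) by apply/factor_theorem/eqP/fs.
exact: fin_all_exists H.
Qed.

(** Cancelling a common zero of [g] and all [a i] lowers the size of [g]; the linear factor lost by
    the equations is recorded in [c]. *)
Lemma normalize_points a b g : (forall i, b i = 0) -> g != 0 ->
  exists a' g' c e, [/\ g' != 0, c != 0, e != 0,
    line_equations a' b g' (point_equations a' g') 1
    & forall y i, c * point_equations a' g' y i = e * point_equations a g y i].
Proof.
move=> b0; move: {2}(size g) (leqnn (size g)) => n.
elim: n a g => [|n IH] a g; first by rewrite leqn0 size_poly_eq0 => ->.
move=> gn g0.
have [[s [gs as0]]|H] := pselect (exists s, g.[s] = 0 /\ forall i, (a i).[s] = 0).
  have [q gq qn] := size_divp_XsubC g0 gs.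
  have [a' a'E] := common_factor as0.
  have q0 : q != 0 by apply: contraNneq g0 => q0; rewrite gq q0 mul0r.
  have [|a1 [g1 [c [e [g10 c0 e0 L E]]]]] := IH a' q _ q0; first by rewrite -ltnS -qn.
  exists a1, g1, (c * ('X - s%:P)), e; split=> //.
    by rewrite mulf_neq0 ?polyXsubC_eq0.
  move=> y i; rewrite mulrAC E /point_equations a'E gq; ring.
exists a, g, 1, 1; split; rewrite ?oner_neq0 //.
apply: point_equations_eqs => // s _ gs.
have /existsNP[i /eqP ai] : ~ forall i, (a i).[s] = 0 by move=> as0; apply: H; exists s.
by exists i.
Qed.

(** Each reduction lowers the size of [g] or of [b i0] and removes one linear factor from all
    minors, recorded in [c]. Subtracting a multiple of b from a only shifts [t] and leaves the
    minors unchanged. *)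
Lemma normalize_lines a b g : (exists i, b i != 0) -> g != 0 ->
  exists a' b' g' c e, [/\ g' != 0, c != 0, e != 0,
    line_equations a' b' g' (line_minors a' b' g') 1
    & forall y ij, c * line_minors a' b' g' y ij = e * line_minors a b g y ij].
Proof.
move=> [i0 bi0]; move: {2}(size g + size (b i0))%N (leqnn (size g + size (b i0))) => n.
elim: n a b g bi0 => [|n IH] a b g bi0 gn g0.
  by rewrite leqn0 addn_eq0 size_poly_eq0 (negbTE g0) in gn.
have Xs0 (s : k) : 'X - s%:P != 0 by rewrite polyXsubC_eq0.
have [[s bs]|H1] := pselect (exists s, forall i, (b i).[s] = 0).
  have [b' b'E] := common_factor bs.
  have bi0' : b' i0 != 0 by apply: contraNneq bi0 => q0; rewrite b'E q0 mul0r.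
  have [|a1 [b1 [g1 [c [e [g10 c0 e0 L E]]]]]] := IH a b' g bi0' _ g0.
    rewrite -ltnS; apply: leq_trans gn.
    by rewrite b'E size_mul ?size_XsubC // addn2 /= addnS.
  exists a1, b1, g1, (c * ('X - s%:P)), e; split=> //; first by rewrite mulf_neq0.
  move=> y i; rewrite mulrAC E /line_minors !b'E; ring.
have bn s : exists i, (b i).[s] != 0.
  have /existsNP[i /eqP bi] : ~ forall i, (b i).[s] = 0 by move=> bs; apply: H1; exists s.
  by exists i.
have [[s [gs ab]]|H2] := pselect (exists s, g.[s] = 0 /\
    forall ij : 'I_3 * 'I_3, (a ij.1).[s] * (b ij.2).[s] = (a ij.2).[s] * (b ij.1).[s]).
  (* [r] is the proportionality factor at [s], read off from an entry where b does not vanish; a - r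
     b then vanishes at [s] together with [g]. *)
  have [j bj] := bn s; pose r := (a j).[s] / (b j).[s].
  have as0 i : (a i - r *: b i).[s] = 0.
    rewrite !(hornerD, hornerN, hornerZ); apply: (mulIf bj).
    by rewrite mul0r mulrBl (ab (i, j)) /r mulrAC divfK // subrr.
  have [a' a'E] := common_factor as0.
  have [q gq qn] := size_divp_XsubC g0 gs.
  have q0 : q != 0 by apply: contraNneq g0 => q0; rewrite gq q0 mul0r.
  have [|a1 [b1 [g1 [c [e [g10 c0 e0 L E]]]]]] := IH a' b q bi0 _ q0.
    by rewrite -ltnS -addSn -qn.
  exists a1, b1, g1, (c * ('X - s%:P)), e; split=> //; first by rewrite mulf_neq0.
  have aE i : a i = a' i * ('X - s%:P) + r *: b i by rewrite -a'E subrK.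
  move=> y i; rewrite mulrAC E /line_minors !aE gq -!mul_polyC; ring.
exists a, b, g, 1, 1; split; rewrite ?oner_neq0 //.
apply: line_minors_eqs => [s _|s _ gs]; first exact: bn.
have /existsNP[ij /eqP abij] : ~ forall ij : 'I_3 * 'I_3,
    (a ij.1).[s] * (b ij.2).[s] = (a ij.2).[s] * (b ij.1).[s].
  by move=> ab; apply: H2; exists s.
by exists ij.
Qed.

End Equations.

(** * The equations under inversion of the parameter *)

Section Inversion.
Variable k : closedFieldType.
Implicit Types (a b : 'I_3 -> {poly k}) (g : {poly k}) (y : affine k 3) (s t : k).

Lemma common_size_bound a b g : exists D, (size g <= D)%N /\
  forall i, (size (a i) <= D)%N /\ (size (b i) <= D)%N.
Proof.
exists (maxn (size g) (\max_i maxn (size (a i)) (size (b i)))); split=> [|i].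
  exact: leq_maxl.
by split; apply: leq_trans (leq_maxr _ _); apply: leq_trans (leq_bigmax i);
  rewrite ?leq_maxl ?leq_maxr.
Qed.

Lemma point_equations_rev a g D y i s : s != 0 ->
  (size g <= D)%N -> (size (a i) <= D)%N ->
  (point_equations (fun i => rev_poly D (a i)) (rev_poly D g) y i).[s] =
  s ^+ D * (point_equations a g y i).[s^-1].
Proof.
move=> s0 gD aD; rewrite /point_equations !(hornerD, hornerN, hornerM, hornerC).
rewrite !horner_rev_poly //; ring.
Qed.

(** The minors are bilinear in the rows a - g y and b, and reversal contributes one factor s^D per
    row. *)
Lemma line_minors_rev a b g D y ij s : s != 0 ->
  (size g <= D)%N -> (forall i, (size (a i) <= D)%N /\ (size (b i) <= D)%N) ->
  (line_minors (fun i => rev_poly D (a i)) (fun i => rev_poly D (b i))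
     (rev_poly D g) y ij).[s] =
  s ^+ D * s ^+ D * (line_minors a b g y ij).[s^-1].
Proof.
move=> s0 gD abD; have [[a1 b1] [a2 b2]] := (abD ij.1, abD ij.2).
rewrite /line_minors !(hornerD, hornerN, hornerM, hornerC).
rewrite !horner_rev_poly //; ring.
Qed.

End Inversion.

(** * The covering theorem *)

Theorem theorem2p10 (k : closedFieldType) (char0 : [pchar k] =i pred0)
    (S : set (affine k 3)) (ruledS : rational_ruled_surface S) :
  exists P1 P2 : 'I_3 -> ratfun2 k,
    [/\ rational_parametrization S P1,
        rational_parametrization S P2
      & S = ratmap_image P1 `|` ratmap_image P2].
Proof.
have [[Sc _ _] [a [b [g [g0 PS]]]]] := ruledS.
have [D [gD abD]] := common_size_bound a b g.
pose ra i := rev_poly D (a i); pose rb i := rev_poly D (b i); pose rg := rev_poly D g.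
have rg0 : rg != 0 by rewrite rev_poly_eq0.
have Xn0 n : 'X^n != 0 :> {poly k} by rewrite expf_neq0 ?polyX_eq0.
have [[i bi]|b0] := pselect (exists i, b i != 0).
  have [|a1 [b1 [g1 [c1 [e1 [g10 c10 e10 L1 E1]]]]]] :=
      @normalize_lines _ a b g _ g0; first by exists i.
  have [|a2 [b2 [g2 [c2 [e2 [g20 c20 e20 L2 E2]]]]]] :=
      @normalize_lines _ ra rb rg _ rg0.
    by exists i; rewrite rev_poly_eq0 // (proj2 (abD i)).
  have [W WE] := line_minors_poly a1 b1 g1.
  (* Where [g] and [b i] are both nonzero, the minors of the given map already describe its lines.
     The powers of ['X] in [e2] come from the reversal of the two rows. *)
  apply: (cover Sc (c0 := g * b i) (e2 := e2 * ('X^D * 'X^D)) PS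
    g0 g10 g20 _ c10 e10 c20 _ _ L1 L2 WE E1).
  - by rewrite mulf_neq0.
  - by rewrite !mulf_neq0.
  - apply: line_minors_eqs => s; rewrite hornerM mulf_eq0 negb_or => /andP[gs bs].
      by exists i.
    by move=> gs0; rewrite gs0 eqxx in gs.
  move=> y ij s s0; rewrite -hornerM E2 !hornerM !hornerXn line_minors_rev //; ring.
(* In the remaining case the map depends on s alone, and [point_equations] takes the place of the
   minors. *)
have {}b0 i : b i = 0 by apply/eqP/negPn/negP => bi; apply: b0; exists i.
have [a1 [g1 [c1 [e1 [g10 c10 e10 L1 E1]]]]] := @normalize_points _ a b g b0 g0.
have [a2 [g2 [c2 [e2 [g20 c20 e20 L2 E2]]]]] := @normalize_points _ ra b rg b0 rg0.
have [W WE] := point_equations_poly a1 g1.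
apply: (cover Sc (c0 := g) (e2 := e2 * 'X^D) PS
  g0 g10 g20 g0 c10 e10 c20 _ _ L1 L2 WE E1).
- by rewrite mulf_neq0.
- apply: point_equations_eqs => // s gs gs0; by rewrite gs0 eqxx in gs.
move=> y i s s0; rewrite -hornerM E2 !hornerM !hornerXn point_equations_rev //.
  ring.
exact: (proj1 (abD i)).
Qed.
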